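(* Let $\Sigma\in\mathbb{R}^{m\times m}$ be symmetric positive definite, $\pi_\mu(u)=\mathcal{N}(u;\mu,\Sigma)$ for $\mu\in\mathbb{R}^m$, and let $F$, $\rho_\mu$, $w$ be as in the context. With preconditioner $P=\frac1\tau\Sigma$ and step size $\eta=1$, the preconditioned gradient update $\mu_{k+1}=\mu_k-\eta P\nabla F(\mu_k)$ is exactly the (expectation-based) MPPI update: $$\mu_{k+1}=\mathbb{E}_{\rho_{\mu_k}}[u]=\frac{\mathbb{E}_{\pi_{\mu_k}}[w(u)\,u]}{\mathbb{E}_{\pi_{\mu_k}}[w(u)]}.$$
   Context: $C\subset\mathbb{R}^m$ is nonempty and compact with positive Lebesgue measure, $f_0:\mathbb{R}^m\to\mathbb{R}$ is continuous, $\tau>0$. $\mathcal{N}(u;\mu,\Sigma)$ is the Gaussian density with mean $\mu$ and covariance $\Sigma$. Define $$w(u):=\exp(-f_0(u)/\tau)\mathbf{1}_C(u),\quad Z(\mu):=\int_C\pi_\mu(u)e^{-f_0(u)/\tau}\,du,\quad F(\mu):=-\tau\log Z(\mu),\quad\rho_\mu(u):=\frac{\pi_\mu(u)w(u)}{Z(\mu)}.$$ *)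

(* Defs.v *)
From HB Require Import structures.
From mathcomp Require Import all_boot all_order all_algebra.
From mathcomp Require Import all_classical all_reals all_analysis.
From mathcomp Require Import measurable_realfun.

Set Implicit Arguments.
Unset Strict Implicit.
Unset Printing Implicit Defensive.

Import Order.TTheory GRing.Theory Num.Theory.
Import numFieldNormedType.Exports.

Local Open Scope classical_set_scope.
Local Open Scope ring_scope.

Section borel.
Variables (R : realType) (m n : nat).

(* Matrices carry the Borel sigma-algebra of their topology. *)
HB.instance Definition _ := @isMeasurable.Build
  (sigma_display (@open 'M[R]_(m, n))) 'M[R]_(m, n) <<s @open 'M[R]_(m, n) >>
  (@sigma_algebra0 _ setT _) (@sigma_algebraC _ _)
  (@sigma_algebra_bigcup _ setT _).

Lemma mx_open_measurable (A : set 'M[R]_(m, n)) : open A -> measurable A.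
Proof. by move=> oA; exact: sub_sigma_algebra. Qed.

Lemma mx_closed_measurable (A : set 'M[R]_(m, n)) : closed A -> measurable A.
Proof.
by move=> /closed_openC/mx_open_measurable/measurableC; rewrite setCK.
Qed.

End borel.

Section lebesgue.
Variable R : realType.

Definition consv m (p : measurableTypeR R * 'cV[R]_m) : 'cV[R]_m.+1 :=
  col_mx (const_mx p.1 : 'cV[R]_1) p.2.

Definition unconsv m (v : 'cV[R]_m.+1) : measurableTypeR R * 'cV[R]_m :=
  (v ord0 ord0, dsubmx (v : 'cV[R]_(1 + m))).

Lemma consv0 m p : @consv m p ord0 ord0 = p.1.
Proof.
have -> : (ord0 : 'I_m.+1) = lshift m (ord0 : 'I_1) by exact: val_inj.
by rewrite /consv (@col_mxEu _ 1) mxE.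
Qed.

Lemma consvS m p i : @consv m p (lift ord0 i) ord0 = p.2 i ord0.
Proof.
have -> : lift ord0 i = rshift 1 i by exact: val_inj.
by rewrite /consv (@col_mxEd _ 1).
Qed.

Lemma consvK m : cancel (@consv m) (@unconsv m).
Proof.
by move=> p; rewrite /unconsv consv0 /consv col_mxKd -surjective_pairing.
Qed.

Lemma unconsvK m : cancel (@unconsv m) (@consv m).
Proof.
move=> v; apply/matrixP => i j; rewrite (ord1 j).
have [k ->|->] := unliftP ord0 i; last by rewrite consv0.
by rewrite consvS /= mxE; congr (v _ _); exact: val_inj.
Qed.

Lemma measurable_consv m : measurable_fun setT (@consv m).
Proof.
apply: (@measurability _ _ _ _ _ _ (@open 'cV[R]_m.+1)) => //.
move=> _ [U oU <-]; rewrite setTI.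
pose box (q : rat * 'cV[rat]_m * nat) :
    set (measurableTypeR R * 'cV[R]_m) :=
  ball (ratr q.1.1 : R) q.2.+1%:R^-1 `*`
  ball (map_mx ratr q.1.2 : 'cV[R]_m) q.2.+1%:R^-1.
have -> : @consv m @^-1` U =
    \bigcup_(q in [set q | box q `<=` @consv m @^-1` U]) box q.
  rewrite eqEsubset; split => [[x v] /= Uxv|xv [q qU] /qU//].
  have /nbhs_ballP[e /= e0 eU] : nbhs (@consv m (x, v)) U.
    by apply: open_nbhs_nbhs.
  have e20 : 0 < e / 2 by rewrite divr_gt0.
  have [k _ /(_ k (leqnn k)) /= ke] := near_infty_natSinv_lt (PosNum e20).
  have k0 : 0 < k.+1%:R^-1 :> R by [].
  have dense (y : R) : {r : rat | ball (ratr r : R) k.+1%:R^-1 y}.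
    apply: cid.
    have /rat_in_itvoo[r] : y - k.+1%:R^-1 < y.
      by rewrite ltrBlDr ltrDl.
    rewrite in_itv/= => /andP[ry yr]; exists r.
    by rewrite /ball/= distrC gtr0_norm ?subr_gt0// ltrBlDl -ltrBlDr.
  exists (sval (dense x), \col_i sval (dense (v i ord0)), k); last first.
    split => /=; first exact: (svalP (dense x)).
    split => // i j; rewrite (ord1 j) !mxE; exact: (svalP (dense _)).
  move=> [y w] [/= yx [_ wv]]; apply: eU; split => // i j; rewrite (ord1 j).
  apply: (le_ball (ltW (_ : k.+1%:R^-1 + k.+1%:R^-1 < e))).
    by rewrite [ltRHS]splitr ltrD.
  have [l ->|->] := unliftP ord0 i.
    rewrite !consvS/=; apply: ball_triangle (wv l ord0).
    by rewrite !mxE; apply: ball_sym; exact: (svalP (dense _)).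
  rewrite !consv0/=; apply: ball_triangle yx.
  by apply: ball_sym; exact: (svalP (dense _)).
rewrite bigcup_mkcond; apply: countable_bigcupT_measurable => // q.
case: ifPn => // _; apply: measurableX.
  by apply: open_measurable; exact: ball_open.
by apply: mx_open_measurable; exact: ball_open.
Qed.

Lemma mx_continuous_measurable m n (f : 'M[R]_(m, n) -> R) :
  continuous f -> measurable_fun setT f.
Proof.
move=> /continuousP cf; apply: (measurability _ (RGenOpens.measurableE R)).
move=> _ [_ [a [b ->]] <-]; rewrite setTI.
by apply: mx_open_measurable; apply: cf; exact: interval_open.
Qed.

Lemma measurable_unconsv m : measurable_fun setT (@unconsv m).
Proof.
apply/measurable_fun_pairP; split.
  exact: mx_continuous_measurable (@coord_continuous _ _ _ ord0 ord0).
apply: (@measurability _ _ _ _ _ _ (@open 'cV[R]_m)) => //.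
move=> _ [U oU <-]; rewrite setTI; apply: mx_open_measurable.
apply: open_comp oU => v _ A /nbhs_ballP[e /= e0 eA].
apply/nbhs_ballP; exists e => // w [_ vw]; apply: eA; split => // i j.
by rewrite !mxE; exact: vw.
Qed.

HB.instance Definition _ m :=
  @isMeasurableFun.Build _ _ _ _ (@consv m) (@measurable_consv m).

Section cons_measure.
Local Open Scope ereal_scope.
Variables (m : nat) (mu : {sigma_finite_measure set 'cV[R]_m -> \bar R}).

Definition cons_measure : set 'cV[R]_m.+1 -> \bar R :=
  pushforward (@lebesgue_measure R \x mu) (@consv m).

Let cons_measure0 : cons_measure set0 = 0.
Proof. exact: measure0. Qed.

Let cons_measure_ge0 A : 0 <= cons_measure A.
Proof. exact: measure_ge0. Qed.

Let cons_measure_sigma_additive : semi_sigma_additive cons_measure.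
Proof. exact: measure_semi_sigma_additive. Qed.

HB.instance Definition _ := isMeasure.Build _ _ _ cons_measure
  cons_measure0 cons_measure_ge0 cons_measure_sigma_additive.

Let cons_measure_sigma_finite : sigma_finite setT cons_measure.
Proof.
have /sigma_finiteP[F [TF ndF Foo]] := sigma_finiteT (@lebesgue_measure R).
have /sigma_finiteP[G [TG ndG Goo]] := sigma_finiteT mu.
exists (fun k => @unconsv m @^-1` (F k `*` G k)).
  rewrite -preimage_bigcup; apply/seteqP; split => // v _.
  have [k _ Fk] : (\bigcup_i F i) (unconsv v).1 by rewrite -TF.
  have [l _ Gl] : (\bigcup_i G i) (unconsv v).2 by rewrite -TG.
  exists (maxn k l) => //; split.
    by move: Fk; apply/subsetPset/ndF/leq_maxl.
  by move: Gl; apply/subsetPset/ndG/leq_maxr.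
move=> k; have [mF Fkoo] := Foo k; have [mG Gkoo] := Goo k.
have mFG := measurableX mF mG; split.
  by rewrite -[X in measurable X]setTI; exact: measurable_unconsv.
rewrite /cons_measure /pushforward/= -comp_preimage.
rewrite (_ : @unconsv m \o @consv m = id); last exact/funext/consvK.
by rewrite preimage_id product_measure1E// lte_mul_pinfty// ge0_fin_numE.
Qed.

HB.instance Definition _ := @Measure_isSigmaFinite.Build _ _ _ cons_measure
  cons_measure_sigma_finite.

End cons_measure.

(* Lebesgue measure on the Borel sets of R^m, as the m-fold product of the
   one-dimensional one; by lebesgue_cV_box and sigma-finiteness it is the
   Borel measure that gives boxes their volume. *)
Fixpoint lebesgue_cV m : {sigma_finite_measure set 'cV[R]_m -> \bar R} :=
  match m with
  | 0 => [the {sigma_finite_measure set 'cV[R]_0 -> \bar R}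
          of dirac (0 : 'cV[R]_0)]
  | m'.+1 => [the {sigma_finite_measure set 'cV[R]_m'.+1 -> \bar R}
              of cons_measure (lebesgue_cV m')]
  end.

Lemma lebesgue_cV_box m (a b : 'cV[R]_m) :
  (forall i, a i ord0 <= b i ord0) ->
  lebesgue_cV m [set v : 'cV[R]_m | forall i, a i ord0 <= v i ord0 <= b i ord0]
  = (\prod_i (b i ord0 - a i ord0))%:E.
Proof.
elim: m a b => [|m IH] a b ab /=.
  by rewrite diracE big_ord0 mem_set// => -[].
rewrite /cons_measure /pushforward.
have boxS (c : 'cV[R]_m.+1) i : (unconsv c).2 i ord0 = c (lift ord0 i) ord0.
  by rewrite mxE; congr (c _ _); exact: val_inj.
have -> : @consv m @^-1`
    [set v : 'cV[R]_m.+1 | forall i, a i ord0 <= v i ord0 <= b i ord0] =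
    `[a ord0 ord0, b ord0 ord0]%classic `*`
    [set v : 'cV[R]_m | forall i,
       (unconsv a).2 i ord0 <= v i ord0 <= (unconsv b).2 i ord0].
  rewrite eqEsubset; split => -[x v] /=.
    move=> H; split=> [|i]; first by have := H ord0; rewrite consv0 in_itv.
    by have := H (lift ord0 i); rewrite consvS !boxS.
  move=> [xab H] i; have [k ->|->] := unliftP ord0 i.
    by have := H k; rewrite consvS !boxS.
  by rewrite consv0; move: xab; rewrite in_itv.
rewrite product_measure1E//; last first.
  rewrite (_ : mkset _ = \bigcap_i [set v : 'cV[R]_m |
       (unconsv a).2 i ord0 <= v i ord0 <= (unconsv b).2 i ord0]); last first.
    by apply/seteqP; split => v /= H i //=; exact: H.
  apply: mx_closed_measurable; apply: closed_bigI => i _.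
  apply: (@preimage_closed _ _ (fun v : 'cV[R]_m => v i ord0)
            [set x | (unconsv a).2 i ord0 <= x <= (unconsv b).2 i ord0]).
    by move=> v _; exact: coord_continuous.
  by rewrite -set_itvcc; exact: interval_closed.
rewrite IH; last by move=> i; rewrite !boxS.
rewrite big_ord_recl EFinM; congr (_ * _)%E; last first.
  by congr (_%:E); apply: eq_bigr => i _; rewrite !boxS.
rewrite -[LHS]/(lebesgue_measure `[a ord0 ord0, b ord0 ord0]%classic).
rewrite lebesgue_measure_itv/= lte_fin.
by case: ltgtP (ab ord0) => // ->; rewrite subrr.
Qed.

End lebesgue.

Section model.
Variables (R : realType) (m : nat).
Local Notation V := 'cV[R]_m.
Local Notation lambda := (lebesgue_cV R m).

Definition sym_posdef (S : 'M[R]_m) : Prop :=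
  S^T = S /\ forall v : V, v != 0 -> 0 < (v^T *m S *m v) ord0 ord0.

Definition gaussian_pdf (mu : V) (S : 'M[R]_m) (u : V) : R :=
  (Num.sqrt ((2 * pi) ^+ m * \det S))^-1 *
  expR (- (((u - mu)^T *m invmx S *m (u - mu)) ord0 ord0 / 2)).

(* E_p[X] for the distribution with Lebesgue density p, for real and for vector
   valued X. The integral is the real-valued one, equal to 0 by convention when
   the extended one is infinite. *)
Definition expect (p X : V -> R) : R := \int[lambda]_u (X u * p u).

Definition expect_vec (p : V -> R) (X : V -> V) : V :=
  \col_i expect p (fun u => X u i ord0).

(* The vector of partial derivatives; it is the gradient only at points where
   f is differentiable. *)
Definition gradient (f : V -> R) (x : V) : V :=
  \col_i 'D_(delta_mx i ord0) f x.

Variables (C : set V) (f0 : V -> R) (tau : R).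

Definition weight (u : V) : R := expR (- f0 u / tau) * \1_C u.

Variable pdf : V -> V -> R. (* [pdf mu] is the density pi_mu *)

Definition partition_fun (mu : V) : R :=
  \int[lambda]_(u in C) (pdf mu u * expR (- f0 u / tau)).

Definition free_energy (mu : V) : R := - tau * ln (partition_fun mu).

Definition tilted_pdf (mu u : V) : R :=
  pdf mu u * weight u / partition_fun mu.

End model.

(* Main.v *)
Require Import Defs.
From HB Require Import structures.
From mathcomp Require Import all_boot all_order all_algebra.
From mathcomp Require Import all_classical all_reals all_analysis.
From mathcomp Require Import ring lra.
From mathcomp Require polyrcf.

Set Implicit Arguments.
Unset Strict Implicit.
Unset Printing Implicit Defensive.

Import Order.TTheory GRing.Theory Num.Theory.
Import numFieldNormedType.Exports.
Local Open Scope classical_set_scope.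
Local Open Scope ring_scope.

(** The free energy is [- tau * ln Z], where [Z mu] integrates the density of the
    Gaussian of mean [mu] and covariance [S] against a fixed continuous weight
    over the compact set [C]. Since the density at mean [mu + h] is the one at
    [mu] multiplied by exp(h^T S^-1 (u - mu) - h^T S^-1 h / 2)
    ([gaussian_pdf_shift]), and [u - mu] is bounded on [C], expanding the
    exponential to first order gives
      Z (mu + h) = Z mu + h^T S^-1 b + O(|h|^2),
    where b is the integral over [C] of (u - mu) times the integrand of [Z mu]
    ([gaussian_integral_remainder]). Thus [Z] is Frechet differentiable, and so is
    the free energy, because [Z] is positive: the integrand is positive and
    continuous on a compact set of positive measure, the determinant of [S] being
    positive ([posdef_det_gt0]).

    The gradient of the free energy is therefore - (tau / Z) S^-1 b
    ([free_energy_gaussian_diff]). The preconditioner S / tau cancels both tau and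
    S^-1, so the unit step moves [mu] to mu + b / Z. As b / Z is the mean of the
    tilted density minus [mu], the new point is that mean. The normalisation by
    [Z] can be pulled out of it, which gives the quotient of expectations
    ([expect_vec_tilted]). *)

(** * Positive definite matrices *)

Lemma posdef_unitmx (R : realType) (m : nat) (S : 'M[R]_m) :
  (forall v : 'cV[R]_m, v != 0 -> 0 < (v^T *m S *m v) ord0 ord0) ->
  S \in unitmx.
Proof.
move=> Spos; rewrite -row_free_unit -kermx_eq0.
apply/rowV0P => x /sub_kermxP xS.
apply/eqP/negPn/negP => x0.
suff /Spos : x^T != 0 by rewrite trmxK xS mul0mx mxE ltxx.
by rewrite -trmx0 (inj_eq (@trmx_inj _ _ _)).
Qed.

(** The characteristic polynomial of [- S], whose value at [t] is
    [\det (t%:M + S)], is monic and has no root [t >= 0], because [t%:M + S] is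
    then positive definite again; so it is positive at [0]. *)
Lemma posdef_det_gt0 (R : realType) (m : nat) (S : 'M[R]_m) :
  (forall v : 'cV[R]_m, v != 0 -> 0 < (v^T *m S *m v) ord0 ord0) ->
  0 < \det S.
Proof.
move=> Spos.
have charE (t : R) : (char_poly (- S)).[t] = \det (t%:M + S).
  rewrite /char_poly -horner_evalE -det_map_mx; congr (\det _).
  apply/matrixP => i j; rewrite !mxE /= /horner_eval.
  by rewrite hornerD hornerMn hornerX hornerN hornerC opprK.
have noroot : {in `[0, +oo[, forall t, ~~ root (char_poly (- S)) t}.
  move=> t; rewrite in_itv/= andbT => t0; rewrite /root charE.
  rewrite -unitfE -/(_ \in unitmx); apply: posdef_unitmx => v v0.
  rewrite mulmxDr mulmxDl mxE ltr_wpDl ?Spos//.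
  rewrite mul_mx_scalar -scalemxAl mxE mulr_ge0// mxE sumr_ge0// => i _.
  by rewrite mxE -expr2 sqr_ge0.
have := @polyrcf.sgp_pinftyP _ 0 _ noroot 0.
rewrite in_itv/= lexx => /(_ isT); rewrite charE -scalemx1 scale0r add0r.
rewrite /polyrcf.sgp_pinfty (monicP (char_poly_monic _)) sgr1.
by move/eqP; rewrite sgr_cp0.
Qed.

(** * Bilinear forms and continuity *)

Section bilinear.
Variables (R : realType) (m : nat).
Implicit Types (x y h u : 'cV[R]_m) (B : 'M[R]_m).

Definition bilform B x y : R := (x^T *m B *m y) ord0 ord0.

Lemma bilformE B x y :
  bilform B x y = \sum_j (\sum_i x i ord0 * B i j) * y j ord0.
Proof.
rewrite /bilform mxE; apply: eq_bigr => j _; rewrite mxE.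
by congr (_ * _); apply: eq_bigr => i _; rewrite mxE.
Qed.

Lemma bilformDl B x x' y : bilform B (x + x') y = bilform B x y + bilform B x' y.
Proof. by rewrite /bilform raddfD/= !mulmxDl mxE. Qed.

Lemma bilformDr B x y y' : bilform B x (y + y') = bilform B x y + bilform B x y'.
Proof. by rewrite /bilform mulmxDr mxE. Qed.

Lemma bilformNl B x y : bilform B (- x) y = - bilform B x y.
Proof. by rewrite /bilform raddfN/= !mulNmx mxE. Qed.

Lemma bilformNr B x y : bilform B x (- y) = - bilform B x y.
Proof. by rewrite /bilform mulmxN mxE. Qed.

Lemma bilformZl B a x y : bilform B (a *: x) y = a * bilform B x y.
Proof. by rewrite /bilform linearZ/= -!scalemxAl mxE. Qed.

Lemma bilformC B x y : B^T = B -> bilform B x y = bilform B y x.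
Proof.
move=> BT; rewrite /bilform -[in LHS](trmxK (_ *m y)) mxE.
by rewrite !trmx_mul trmxK BT mulmxA.
Qed.

Lemma bilform_delta B y i : bilform B (delta_mx i ord0) y = (B *m y) i ord0.
Proof. by rewrite /bilform trmx_delta -mulmxA -rowE mxE. Qed.

Lemma ler_coord_norm x i : `|x i ord0| <= `|x|.
Proof.
rewrite [leRHS]mx_normrE.
by rewrite (le_bigmax _ (fun ij => `|x ij.1 ij.2|) (i, ord0)).
Qed.

Lemma bilform_bounded B :
  exists2 K, 0 <= K & forall x y, `|bilform B x y| <= K * (`|x| * `|y|).
Proof.
exists (\sum_j \sum_i `|B i j|).
  by apply: sumr_ge0 => j _; exact: sumr_ge0.
move=> x y; rewrite bilformE mulr_suml.
apply: (le_trans (ler_norm_sum _ _ _)); apply: ler_sum => j _.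
rewrite normrM mulrA ler_pM ?ler_coord_norm// mulr_suml.
apply: (le_trans (ler_norm_sum _ _ _)); apply: ler_sum => i _.
by rewrite normrM mulrC ler_wpM2l ?ler_coord_norm.
Qed.

(** These pointwise forms are stated for an arbitrary topological domain: on a
    space of matrices the filter of neighbourhoods unfolds during unification,
    and the lemmas on limits no longer apply. *)
Lemma continuous_mulR (T : topologicalType) (f g : T -> R) :
  continuous f -> continuous g -> continuous (fun t => f t * g t).
Proof. by move=> cf cg t; apply: cvgM; [exact: cf|exact: cg]. Qed.

Lemma continuous_subR (T : topologicalType) (f g : T -> R) :
  continuous f -> continuous g -> continuous (fun t => f t - g t).
Proof. by move=> cf cg t; apply: cvgB; [exact: cf|exact: cg]. Qed.

Lemma continuous_normR (T : topologicalType) (f : T -> R) :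
  continuous f -> continuous (fun t => `|f t|).
Proof. by move=> cf t; apply: cvg_norm; exact: cf. Qed.

Lemma continuous_translation (V : normedModType R) (a : V) :
  continuous (fun u : V => u - a).
Proof. by move=> v; apply: cvgB; [exact: cvg_id|exact: cvg_cst]. Qed.

Lemma continuous_expRNdiv (T : topologicalType) (f : T -> R) (a : R) :
  continuous f -> continuous (fun t => expR (- f t / a)).
Proof.
move=> cf t; apply: (@continuous_comp _ _ _ (fun t => - f t / a) expR).
  by apply: cvgMl; apply: cvgN; exact: cf.
exact: continuous_expR.
Qed.

Lemma continuous_coord (T : topologicalType) (f : T -> 'cV[R]_m) i :
  continuous f -> continuous (fun t => f t i ord0).
Proof.
move=> cf t; apply: (@continuous_comp _ _ _ f (fun v : 'cV[R]_m => v i ord0)).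
  exact: cf.
exact: coord_continuous.
Qed.

Lemma continuous_bilform (T : topologicalType) B (f g : T -> 'cV[R]_m) :
  continuous f -> continuous g -> continuous (fun t => bilform B (f t) (g t)).
Proof.
move=> cf cg.
have csum (F : 'I_m -> T -> R) : (forall i, continuous (F i)) ->
    continuous (fun t => \sum_i F i t).
  move=> cF.
  exact: (continuous_big (@add_continuous R^o) (fun i _ => cF i)).
rewrite (_ : (fun t => _) =
  fun t => \sum_j (\sum_i f t i ord0 * B i j) * g t j ord0); last first.
  by apply/funext => t; rewrite bilformE.
apply: (csum) => j t; apply: cvgM; last exact: continuous_coord.
apply: (csum) => i {}t.
by apply: cvgM; [exact: continuous_coord|exact: cvg_cst].
Qed.

End bilinear.

(** * Differentiability from a quadratic remainder *)

(** Both bounds come from [1 + y <= expR y]: at [x] it makes the remainder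
    nonnegative, and at [- x] it gives [expR x <= (1 - x)^-1], whence
    [expR x - 1 - x <= x ^+ 2 * (1 - x)^-1]. *)
Lemma expR_quadratic_remainder (R : realType) (x : R) :
  `|x| <= 2^-1 -> `|expR x - 1 - x| <= 2 * x ^+ 2.
Proof.
rewrite ler_norml => /andP[x1 x2].
have e1 := expR_ge1Dx x.
have e2 : expR x * (1 - x) <= 1.
  by rewrite -[leRHS](expRxMexpNx_1 x) ler_wpM2l ?expR_ge0 ?expR_ge1Dx.
have e3 : expR x <= 2 by have := expR_ge0 x; nra.
rewrite ger0_norm; last lra.
nra.
Qed.

Lemma is_diff_quadratic_remainder (R : realType) (V W : normedModType R)
    (f : V -> W) (L : {linear V -> W}) (x : V) (K d : R) :
  0 < d -> continuous L ->
  (forall h, `|h| <= d -> `|f (x + h) - f x - L h| <= K * `|h| ^+ 2) ->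
  differentiable f x /\ 'd f x = L :> (V -> W).
Proof.
move=> d0 cL fL.
have fo : f \o shift x = cst (f x) + L +o_ 0 id.
  apply/eqaddoP => e /= e0; near=> h.
  have -> : (f \o shift x - (cst (f x) + L)) h = f (x + h) - f x - L h.
    by rewrite !fctE/= opprD addrA [h + x]addrC.
  apply: le_trans (fL _ _) _.
    by near: h; apply/nbhs0_le => //; exact: d0.
  rewrite expr2 mulrA ler_wpM2r//.
  have : `|h| <= e / (1 + `|K|).
    by near: h; apply: nbhs0_le; rewrite divr_gt0// ltr_pwDl.
  rewrite ler_pdivlMr ?ltr_pwDl// => he.
  by rewrite (le_trans _ he)// mulrC ler_wpM2l// ler_wpDl// ler_norm.
have dfL := diff_unique cL fo.
by split => //; apply/diff_locallyP; rewrite dfL.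
Unshelve. all: by end_near. Qed.

(** * Integrals of continuous functions over a compact set *)

Section compact.
Variables (R : realType) (m : nat) (C : set 'cV[R]_m).
Hypothesis C_compact : compact C.
Local Notation lambda := (lebesgue_cV R m).

Lemma compact_cV_measurable : measurable C.
Proof.
by apply: mx_closed_measurable; apply: compact_closed => //; exact: norm_hausdorff.
Qed.

(** A compact set lies in a box, whose measure is known. *)
Lemma compact_lebesgue_cV_lty : (lambda C < +oo)%E.
Proof.
have [M [_ CM]] := compact_bounded C_compact.
pose r : R := `|M| + 1.
have Cr u : C u -> `|u| <= r.
  by apply: CM; rewrite /r (le_lt_trans (ler_norm _)) ?ltrDl.
pose box := [set v : 'cV[R]_m | forall i,
  (const_mx (- r) : 'cV[R]_m) i ord0 <= v i ord0
    <= (const_mx r : 'cV[R]_m) i ord0].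
have r0 : 0 <= r by rewrite /r addr_ge0.
have Cbox : C `<=` box.
  move=> u /Cr ur i; rewrite !mxE -ler_norml.
  by apply: le_trans ur; exact: ler_coord_norm.
have mbox : measurable box.
  rewrite (_ : box = \bigcap_i [set v : 'cV[R]_m | - r <= v i ord0 <= r]).
    apply: mx_closed_measurable; apply: closed_bigI => i _.
    apply: (@preimage_closed _ _ (fun v : 'cV[R]_m => v i ord0)
              [set x | - r <= x <= r]).
      by move=> v _; exact: coord_continuous.
    by rewrite -set_itvcc; exact: interval_closed.
  by apply/seteqP; split => v /= H i; have := H i; rewrite !mxE//; exact.
apply: (@le_lt_trans _ _ (lambda box)).
  by apply: le_measure; rewrite ?inE//; exact: compact_cV_measurable.
by rewrite lebesgue_cV_box ?ltry// => i; rewrite !mxE ge0_cp.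
Qed.

Lemma integrable_compact (f : 'cV[R]_m -> R) :
  continuous f -> lambda.-integrable C (EFin \o f).
Proof.
move=> cf; apply: measurable_bounded_integrable.
- exact: compact_cV_measurable.
- exact: compact_lebesgue_cV_lty.
- by apply: measurable_funTS; exact: mx_continuous_measurable.
- have : compact (f @` C).
    by apply: continuous_compact => //; exact: continuous_subspaceT.
  move=> /compact_bounded[M [_ Mf]].
  by exists M; split; rewrite ?num_real// => ? ? ? ?; exact: Mf.
Qed.

(** The integrand is bounded below by its minimum over [C], which is positive. *)
Lemma Rintegral_compact_gt0 (f : 'cV[R]_m -> R) :
  C !=set0 -> (0 < lambda C)%E -> continuous f -> (forall u, C u -> 0 < f u) ->
  0 < \int[lambda]_(u in C) f u.
Proof.
move=> C0 lC cf f0.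
have [c] := compact_EVT_min C0 C_compact (continuous_subspaceT cf).
rewrite inE => Cc fc.
have mC := compact_cV_measurable.
apply: (@lt_le_trans _ _ (\int[lambda]_(u in C) f c)).
  rewrite Rintegral_cst// mulr_gt0 ?f0// fine_gt0// lC.
  exact: compact_lebesgue_cV_lty.
apply: le_Rintegral => //.
- by apply: (@integrable_compact (cst (f c))); exact: cst_continuous.
- exact: integrable_compact.
- by move=> u Cu; apply: fc; rewrite inE.
Qed.

(** A linear functional commutes with the integral of a vector-valued function;
    the coordinates are summed by induction on the list of indices. *)
Lemma bilform_Rintegral (B : 'M[R]_m) (h : 'cV[R]_m)
    (g : 'cV[R]_m -> 'cV[R]_m) (W : 'cV[R]_m -> R) :
  continuous g -> continuous W ->
  \int[lambda]_(u in C) (bilform B h (g u) * W u) =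
  bilform B h (\col_i \int[lambda]_(u in C) (g u i ord0 * W u)).
Proof.
move=> cg cW.
have cgW i : continuous (fun u => g u i ord0 * W u).
  by apply: continuous_mulR => //; exact: continuous_coord.
have mC := compact_cV_measurable.
rewrite bilformE.
under eq_Rintegral do rewrite bilformE mulr_suml.
pose a j := \sum_i h i ord0 * B i j.
suff: forall s : seq 'I_m,
    lambda.-integrable C (EFin \o (fun u => \sum_(j <- s) a j * g u j ord0 * W u)) /\
    \int[lambda]_(u in C) (\sum_(j <- s) a j * g u j ord0 * W u) =
    \sum_(j <- s) a j * \int[lambda]_(u in C) (g u j ord0 * W u).
  move=> /(_ (index_enum 'I_m))[_ ->].
  by apply: eq_bigr => j _; rewrite mxE.
elim=> [|j s [IHi IH]].
  under eq_Rintegral do rewrite big_nil.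
  rewrite big_nil Rintegral_cst// mul0r; split => //.
  apply: integrable_compact; rewrite [X in continuous X](_ : _ = cst 0).
    exact: cst_continuous.
  by apply/funext => u; rewrite big_nil.
have ci : lambda.-integrable C (EFin \o (fun u => a j * (g u j ord0 * W u))).
  by apply: integrable_compact; apply: continuous_mulR => //; exact: cst_continuous.
under eq_Rintegral do rewrite big_cons -mulrA.
rewrite big_cons RintegralD// RintegralZl//; last exact: integrable_compact.
rewrite IH; split=> //.
rewrite (_ : _ \o _ = (EFin \o (fun u => a j * (g u j ord0 * W u))) \+
  (EFin \o (fun u => \sum_(j <- s) a j * g u j ord0 * W u))); last first.
  by apply/funext => u /=; rewrite big_cons mulrA EFinD.
exact: integrableD.
Qed.

End compact.

(** * Gaussian densities *)

Section gaussian.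
Variables (R : realType) (m : nat) (S : 'M[R]_m).
Implicit Types (mu h u : 'cV[R]_m).
Local Notation B := (invmx S).

Lemma gaussian_pdfE mu u : gaussian_pdf mu S u =
  (Num.sqrt ((2 * pi) ^+ m * \det S))^-1 *
  expR (- (bilform B (u - mu) (u - mu) / 2)).
Proof. by []. Qed.

Lemma gaussian_pdf_gt0 mu u : 0 < \det S -> 0 < gaussian_pdf mu S u.
Proof.
move=> S0; rewrite gaussian_pdfE mulr_gt0 ?expR_gt0//.
by rewrite invr_gt0 sqrtr_gt0 mulr_gt0 ?exprn_gt0 ?mulr_gt0 ?pi_gt0.
Qed.

(** Translating the mean only multiplies the density by an exponential that is
    affine in [u], which makes the dependence on the mean explicit. *)
Lemma gaussian_pdf_shift mu h u : S^T = S ->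
  gaussian_pdf (mu + h) S u = gaussian_pdf mu S u *
    expR (bilform B h (u - mu) - bilform B h h / 2).
Proof.
move=> ST; rewrite !gaussian_pdfE -mulrA -expRD; congr (_ * expR _).
have BT : B^T = B by rewrite trmx_inv ST.
rewrite opprD addrA bilformDl !bilformDr !bilformNl !bilformNr.
rewrite !bilformDl !bilformNl (bilformC u h BT) (bilformC mu h BT).
by field.
Qed.

Lemma continuous_gaussian_pdf mu : continuous (gaussian_pdf mu S).
Proof.
have csub : continuous (fun u => u - mu).
  exact: continuous_translation.
apply: continuous_mulR; first exact: cst_continuous.
under eq_fun do rewrite -mulNr.
by apply: continuous_expRNdiv; exact: continuous_bilform.
Qed.

End gaussian.

(** * Differentiation in the mean of a Gaussian *)

Section differentiation.
Variables (R : realType) (m : nat) (C : set 'cV[R]_m) (S : 'M[R]_m).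
Variable phi : 'cV[R]_m -> R.
Hypothesis C_compact : compact C.
Hypothesis S_sym : S^T = S.
Hypothesis phi_cont : continuous phi.
Hypothesis phi_ge0 : forall u, 0 <= phi u.
Local Notation lambda := (lebesgue_cV R m).
Local Notation B := (invmx S).
Implicit Types (mu h u : 'cV[R]_m).

(** At [phi u = expR (- f0 u / tau)] this is the partition function. *)
Definition gaussian_integral mu : R :=
  \int[lambda]_(u in C) (gaussian_pdf mu S u * phi u).

Local Notation Z := gaussian_integral.
Local Notation W mu u := (gaussian_pdf mu S u * phi u).

(** By [gaussian_pdf_shift] the integrand of the left-hand side is the weight at
    [mu] times [expR x - 1 - l], where [l := bilform B h (u - mu)] is the linear
    term and [x := l - bilform B h h / 2]. On [C] the vector [u - mu] is bounded,
    so [x] is O(|h|) and [expR x - 1 - l = (expR x - 1 - x) - bilform B h h / 2]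
    is O(|h|^2), uniformly in [u]; the integral inherits the bound. *)
Lemma gaussian_integral_remainder mu : 0 < \det S ->
  exists K, exists2 d, 0 < d & forall h, `|h| <= d ->
    `|Z (mu + h) - Z mu -
      \int[lambda]_(u in C) (bilform B h (u - mu) * W mu u)| <= K * `|h| ^+ 2.
Proof.
move=> S0.
have [K0 K00 BK] := bilform_bounded B.
have cW nu : continuous (fun u => W nu u).
  by apply: continuous_mulR => //; exact: continuous_gaussian_pdf.
have W0 nu u : 0 <= W nu u by rewrite mulr_ge0// ltW// gaussian_pdf_gt0.
have csub : continuous (fun u => u - mu).
  exact: continuous_translation.
have clin h : continuous (fun u => bilform B h (u - mu) * W mu u).
  apply: continuous_mulR => //; apply: continuous_bilform => //.
  exact: cst_continuous.
have [M M0 CM] : exists2 M, 0 <= M & forall u, C u -> `|u - mu| <= M.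
  have : compact ((fun u => u - mu) @` C).
    by apply: continuous_compact => //; exact: continuous_subspaceT.
  move=> /compact_bounded[M [_ MC]]; exists (`|M| + 1) => [|u Cu].
    by rewrite addr_ge0.
  apply: MC; last by exists u.
  by rewrite (le_lt_trans (ler_norm _)) ?ltrDl.
have [A A0 AE] : exists2 A, 0 <= A & A = K0 * (M + 1).
  by exists (K0 * (M + 1)) => //; rewrite mulr_ge0// addr_ge0.
(* [A * `|h|] bounds the exponent when [`|h| <= 1]; the radius below enforces
   both [`|h| <= 1] and [A * `|h| <= 1 / 2], as [expR_quadratic_remainder]
   demands. *)
exists ((2 * A ^+ 2 + K0) * Z mu), (1 + 2 * A)^-1.
  by rewrite invr_gt0 ltr_pwDl// mulr_ge0.
move=> h hd.
have hA : 0 <= `|h| /\ `|h| + 2 * (A * `|h|) <= 1.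
  split => //; move: hd; rewrite -div1r ler_pdivlMr ?ltr_pwDl ?mulr_ge0//.
  lra.
have mC := compact_cV_measurable C_compact.
have iC f := @integrable_compact _ _ C C_compact f.
have i1 := iC _ (cW (mu + h)); have i2 := iC _ (cW mu); have i3 := iC _ (clin h).
have c12 : continuous (fun u => W (mu + h) u - W mu u).
  by exact: continuous_subR.
have c123 : continuous (fun u => W (mu + h) u - W mu u - bilform B h (u - mu) * W mu u).
  by exact: continuous_subR.
rewrite /gaussian_integral -(RintegralB mC i1 i2) -(RintegralB mC _ i3)//; last first.
  exact: iC.
apply: le_trans (le_normr_Rintegral _ _) _ => //; first exact: iC.
rewrite mulrAC -RintegralZl//.
have cK (a : R) : continuous (fun u => a * W mu u).
  by apply: continuous_mulR => //; exact: cst_continuous.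
apply: le_Rintegral => //; [|exact: iC|].
  by apply: iC; exact: continuous_normR.
move=> u Cu; rewrite gaussian_pdf_shift//.
set l := bilform B h (u - mu); set q := bilform B h h.
rewrite [X in `|X|](_ : _ = W mu u * (expR (l - q / 2) - 1 - l)); last first.
  by ring.
rewrite normrM ger0_norm// mulrC ler_wpM2r//.
have lA : `|l| <= K0 * M * `|h|.
  apply: le_trans (BK _ _) _; rewrite -mulrA ler_wpM2l// mulrC.
  by rewrite ler_wpM2r// CM.
have qA : `|q| <= K0 * `|h| ^+ 2 by apply: le_trans (BK _ _) _.
have xA : `|l - q / 2| <= A * `|h|.
  apply: le_trans (ler_normB _ _) _; rewrite normrM.
  rewrite (ger0_norm (_ : 0 <= 2^-1 :> R)) ?invr_ge0//.
  have : K0 * `|h| ^+ 2 <= K0 * `|h|.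
    rewrite ler_wpM2l// expr2 ler_piMl//; have : 0 <= A * `|h| by rewrite mulr_ge0.
    lra.
  rewrite AE mulrDr mulrDl mulr1; have := normr_ge0 q; lra.
have xE : `|expR (l - q / 2) - 1 - (l - q / 2)| <= 2 * (l - q / 2) ^+ 2.
  by apply: expR_quadratic_remainder; lra.
have x2 : (l - q / 2) ^+ 2 <= A ^+ 2 * `|h| ^+ 2.
  by rewrite -exprMn -real_normK ?num_real// lerXn2r ?nnegrE// mulr_ge0.
rewrite [X in `|X|](_ : _ = (expR (l - q / 2) - 1 - (l - q / 2)) - q / 2); last by ring.
apply: le_trans (ler_normB _ _) _; rewrite normrM.
rewrite (ger0_norm (_ : 0 <= 2^-1 :> R)) ?invr_ge0//.
have := normr_ge0 q; lra.
Qed.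

Lemma gaussian_integral_diff mu : 0 < \det S ->
  differentiable Z mu /\ forall h, 'd Z mu h =
   bilform B h (\col_i \int[lambda]_(u in C) ((u - mu) i ord0 * W mu u)).
Proof.
move=> S0; set b := \col_i _.
have cW : continuous (fun u => W mu u).
  by apply: continuous_mulR => //; exact: continuous_gaussian_pdf.
have csub : continuous (fun u => u - mu).
  exact: continuous_translation.
pose L h : R := bilform B h b.
have Llin : linear L by move=> a x y; rewrite /L bilformDl bilformZl.
pose LL : {linear 'cV[R]_m -> R} :=
  HB.pack L (GRing.isLinear.Build _ _ _ _ L Llin).
have cL : continuous LL.
  by apply: continuous_bilform; [move=> ?; exact: cvg_id|exact: cst_continuous].
have [K [d d0 Zd]] := gaussian_integral_remainder mu S0.
have [|dZ ->] := @is_diff_quadratic_remainder R _ _ Z LL mu K d d0 cL; last by [].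
move=> h hd; have := Zd h hd.
by rewrite (bilform_Rintegral C_compact B h csub cW).
Qed.

End differentiation.

(** * The tilted density and the free energy *)

Section tilting.
Variables (R : realType) (m : nat) (C : set 'cV[R]_m).
Variables (f0 : 'cV[R]_m -> R) (tau : R).
Local Notation lambda := (lebesgue_cV R m).

Lemma Rintegral_weight (g : 'cV[R]_m -> R) :
  \int[lambda]_u (g u * weight C f0 tau u) =
  \int[lambda]_(u in C) (g u * expR (- f0 u / tau)).
Proof.
rewrite [RHS]Rintegral_mkcond; apply: eq_Rintegral => u _.
rewrite patchE /weight indicE mulrA.
by case: (u \in C); rewrite ?mulr1 ?mulr0.
Qed.

Variable pdf : 'cV[R]_m -> 'cV[R]_m -> R.

Lemma expect_weight mu :
  expect (pdf mu) (weight C f0 tau) = partition_fun C f0 tau pdf mu.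
Proof.
rewrite /partition_fun -Rintegral_weight.
by apply: eq_Rintegral => u _; rewrite mulrC.
Qed.

Lemma expect_vec_weight mu :
  expect_vec (pdf mu) (fun u => weight C f0 tau u *: u) =
  \col_i \int[lambda]_(u in C) (u i ord0 * (pdf mu u * expR (- f0 u / tau))).
Proof.
apply/matrixP => i j; rewrite !mxE.
under [RHS]eq_Rintegral do rewrite mulrA.
rewrite -Rintegral_weight; apply: eq_Rintegral => u _.
by rewrite mxE; ring.
Qed.

Hypothesis C_compact : compact C.
Hypothesis f0_cont : continuous f0.

Lemma continuous_pdf_expR mu : continuous (pdf mu) ->
  continuous (fun u => pdf mu u * expR (- f0 u / tau)).
Proof. by move=> cpdf; apply: continuous_mulR => //; exact: continuous_expRNdiv. Qed.

Lemma expect_vec_tilted mu : continuous (pdf mu) ->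
  expect_vec (tilted_pdf C f0 tau pdf mu) id =
  (partition_fun C f0 tau pdf mu)^-1 *:
    expect_vec (pdf mu) (fun u => weight C f0 tau u *: u).
Proof.
move=> cpdf; rewrite expect_vec_weight; apply/matrixP => i j; rewrite !mxE.
rewrite -RintegralZl//; last 2 first.
- exact: compact_cV_measurable.
- apply: integrable_compact => //; apply: continuous_mulR.
    by apply: continuous_coord => u; exact: cvg_id.
  exact: continuous_pdf_expR.
under [RHS]eq_Rintegral do rewrite 2!mulrA.
rewrite -Rintegral_weight; apply: eq_Rintegral => u _.
by rewrite /tilted_pdf; ring.
Qed.

End tilting.

(** The score formula: the gradient of [- tau * ln Z] is [- (tau / Z)] times that
    of the partition function [Z], which [gaussian_integral_diff] provides. *)
Lemma free_energy_gaussian_diff (R : realType) (m : nat) (C : set 'cV[R]_m)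
    (f0 : 'cV[R]_m -> R) (tau : R) (S : 'M[R]_m)
    (pi_ := fun mu : 'cV[R]_m => gaussian_pdf mu S) (mu : 'cV[R]_m) :
  compact C -> continuous f0 -> S^T = S -> 0 < \det S ->
  0 < partition_fun C f0 tau pi_ mu ->
  differentiable (free_energy C f0 tau pi_) mu /\
  gradient (free_energy C f0 tau pi_) mu =
    - (tau / partition_fun C f0 tau pi_ mu) *: (invmx S *m
      \col_i \int[lebesgue_cV R m]_(u in C)
        ((u - mu) i ord0 * (pi_ mu u * expR (- f0 u / tau)))).
Proof.
move=> cC cf0 ST S0 Z0; set b := \col_i _.
set Z := partition_fun C f0 tau pi_.
have [dZ dZE] : differentiable Z mu /\ forall h, 'd Z mu h = bilform (invmx S) h b.
  apply: (gaussian_integral_diff cC ST (phi := fun u => expR (- f0 u / tau))) => //.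
  exact: continuous_expRNdiv.
have dln : is_derive (Z mu) 1 (@ln R) (Z mu)^-1 by exact: is_derive1_ln.
have lnd : differentiable (@ln R) (Z mu) by apply/derivable1_diffP; case: dln.
have lnZd : differentiable (@ln R \o Z) mu by exact: differentiable_comp.
have FE : free_energy C f0 tau pi_ = (- tau) *: (@ln R \o Z : 'cV[R]_m -> R) by [].
have dF : differentiable (free_energy C f0 tau pi_) mu.
  by rewrite FE; exact: differentiableZ.
split => //; apply/matrixP => i j; rewrite (ord1 j) [LHS]mxE [RHS]mxE.
rewrite deriveE// FE diffZ// diff_comp//= dZE bilform_delta diff1E// derive1E.
have [_ ->] := dln.
by rewrite /GRing.scale/=; ring.
Qed.

(** * The preconditioned gradient step *)

Theorem mainTheorem5 (R : realType) (m : nat) (C : set 'cV[R]_m)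
    (f0 : 'cV[R]_m -> R) (tau : R) (Sigma : 'M[R]_m)
    (C_neq0 : C !=set0) (C_compact : compact C)
    (C_gt0 : (0 < lebesgue_cV R m C)%E)
    (f0_cont : continuous f0) (tau_gt0 : 0 < tau)
    (Sigma_spd : sym_posdef Sigma) :
  let pi_ (mu : 'cV[R]_m) := gaussian_pdf mu Sigma in
  let w := weight C f0 tau in
  let F := free_energy C f0 tau pi_ in
  let rho := tilted_pdf C f0 tau pi_ in
  let P := tau^-1 *: Sigma in
  let eta := 1 in
  (forall mu : 'cV[R]_m, differentiable F mu) /\
  forall mu : 'cV[R]_m,
    mu - eta *: (P *m gradient F mu) = expect_vec (rho mu) (fun u => u) /\
    expect_vec (rho mu) (fun u => u) =
      (expect (pi_ mu) w)^-1 *: expect_vec (pi_ mu) (fun u => w u *: u).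
Proof.
move=> pi_ w F rho P eta.
have [ST Spos] := Sigma_spd.
have S0 := posdef_det_gt0 Spos.
have cpi mu : continuous (pi_ mu) by exact: continuous_gaussian_pdf.
have cW mu : continuous (fun u => pi_ mu u * expR (- f0 u / tau)).
  exact: continuous_pdf_expR.
have Z0 mu : 0 < partition_fun C f0 tau pi_ mu.
  apply: Rintegral_compact_gt0 => // u Cu.
  by rewrite mulr_gt0 ?expR_gt0// gaussian_pdf_gt0.
have FD mu := free_energy_gaussian_diff C_compact f0_cont ST S0 (Z0 mu).
have EE mu : expect_vec (rho mu) (fun u => u) =
    (expect (pi_ mu) w)^-1 *: expect_vec (pi_ mu) (fun u => w u *: u).
  by rewrite expect_weight; exact: expect_vec_tilted.
split => mu; first by have [] := FD mu.
split => //; rewrite EE /eta /P /F scale1r.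
have [_ ->] := FD mu.
have Z1 := lt0r_neq0 (Z0 mu); have t1 := lt0r_neq0 tau_gt0.
rewrite -scalemxAr -scalemxAl mulKVmx; last exact: posdef_unitmx.
rewrite expect_weight expect_vec_weight; apply/matrixP => i j; rewrite (ord1 j).
rewrite !mxE.
have cu (k : 'I_m) : continuous (fun u : 'cV[R]_m => u k ord0).
  exact: coord_continuous.
(* It remains to compare first moments: centring at [mu] subtracts [mu] times the
   partition function. *)
have -> : \int[lebesgue_cV R m]_(u in C)
    ((u - mu) i ord0 * (pi_ mu u * expR (- f0 u / tau))) =
  \int[lebesgue_cV R m]_(u in C) (u i ord0 * (pi_ mu u * expR (- f0 u / tau)))
    - mu i ord0 * partition_fun C f0 tau pi_ mu.
  rewrite /partition_fun -RintegralZl//; last 2 first.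
  - exact: compact_cV_measurable.
  - exact: integrable_compact.
  rewrite -RintegralB//; last 3 first.
  - exact: compact_cV_measurable.
  - by apply: integrable_compact => //; exact: continuous_mulR.
  - apply: integrable_compact => //; apply: continuous_mulR => //.
    exact: cst_continuous.
  by apply: eq_Rintegral => u _; rewrite !mxE mulrBl.
by field; rewrite Z1.
Qed.
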